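(* Let $\kappa:\mathcal C\to\mathbb R$ be a measure of concordance of degree at most two, and let $\nu^\kappa=(\nu^\kappa_C)_{C\in\mathcal C}$ be its associated admissible field. Then $\kappa$ is affine on $\mathcal C$ (i.e. has degree one) if and only if the field is constant, that is, $\nu^\kappa_C=\tfrac12\nu$ for all $C\in\mathcal C$ for some $\nu\in\mathfrak M_w^+$ with $\kappa(C)=\int_{(0,1)^2}(C-\Pi)\,\mathrm d\nu$ for all $C\in\mathcal C$. Equivalently, $\kappa$ has exact degree two if and only if the field $C\mapsto\nu_C^\kappa$ is not constant.
   Context: $\mathcal C$ is the set of all bivariate copulas, with the uniform topology; $\mu_C$ is the Borel probability measure on $[0,1]^2$ associated with $C\in\mathcal C$. $M(u,v)=\min(u,v)$, $W(u,v)=\max(u+v-1,0)$, $\Pi(u,v)=uv$. $C\preceq D$ means $C(u,v)\le D(u,v)$ for all $(u,v)\in[0,1]^2$. $\mathcal D_4$ is the (8-element) symmetry group of $[0,1]^2$ generated by $\pi(u,v)=(v,u)$ and $\sigma_1(u,v)=(1-u,v)$ under composition. For $\gamma\in\mathcal D_4$ and $C\in\mathcal C$, $C^\gamma$ is the copula with $\mu_{C^\gamma}=\gamma_\#\mu_C$, where $\gamma_\#\mu(A)=\mu(\gamma^{-1}(A))$. A functional $\kappa:\mathcal C\to\mathbb R$ is a measure of concordance if: (A1) $\kappa(C^\pi)=\kappa(C)$ for every $C$; (A2) $C\preceq D$ implies $\kappa(C)\le\kappa(D)$; (A3) $\kappa(M)=1$; (A4) $\kappa(C^{\sigma_1})=-\kappa(C)$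 for every $C$; (A5) $C_n\to C$ uniformly implies $\kappa(C_n)\to\kappa(C)$. $\kappa:\mathcal C\to\mathbb R$ has degree at most two if for every $C,D\in\mathcal C$ the map $t\mapsto\kappa((1-t)C+tD)$ agrees on $[0,1]$ with a real polynomial of degree at most two; it has exact degree two if it has degree at most two but is not affine on $\mathcal C$. The canonical polarization of $\kappa$ is $b_\kappa(C,D)=2\kappa\left(\frac{C+D}{2}\right)-\frac{\kappa(C)+\kappa(D)}{2}$, $C,D\in\mathcal C$. Let $w=M-W$, i.e. $w(u,v)=\min\{u,v,1-u,1-v\}$. $\mathfrak M_w^+$ is the set of non-negative Borel measures $\nu$ on $(0,1)^2$ with $\int_{(0,1)^2}w\,\mathrm d\nu<\infty$. Since $|C-\Pi|\le w$ for every copula $C$, integrals of $C-\Pi$ against such measures are finite; integrals against a difference of two such measures mean the difference of the integrals. A field $\nu=(\nu_C)_{C\in\mathcal C}$ of measures is admissible if: (P1) $\nu_C\in\mathfrak M_w^+$ for every $C\in\mathcal C$; (P2) $\nu_{(1-t)C+tD}=(1-t)\nu_C+t\nu_D$ for all $C,D\in\mathcal C$, $0\le t\le1$; (P3) $\int_{(0,1)^2}(D-\Pi)\,\mathrm d(\nu_C-\nu_\Pi)=\int_{(0,1)^2}(C-\Pi)\,\mathrm d(\nu_D-\nu_\Pi)$ for all $C,D\in\mathcal C$; (P4) $\nu_{C^\gamma}=\gamma_\#\nu_C$ for all $C\in\mathcal C$, $\gamma\in\mathcal D_4$; (P5) the map $C\mapsto\int_{(0,1)^2}(C-\Pi)\,\mathrm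 d\nu_\Pi+\int_{(0,1)^2}(C-\Pi)\,\mathrm d\nu_C$ is continuous on $\mathcal C$; (P6) $\int_{(0,1)^2}(M-\Pi)\,\mathrm d\nu_\Pi+\int_{(0,1)^2}(M-\Pi)\,\mathrm d\nu_M=1$. For a measure of concordance $\kappa$ of degree at most two, its associated admissible field $\nu^\kappa$ is the unique admissible field with $b_\kappa(C,D)=\int_{(0,1)^2}(C-\Pi)\,\mathrm d\nu^\kappa_\Pi+\int_{(0,1)^2}(D-\Pi)\,\mathrm d\nu^\kappa_C$ for all $C,D\in\mathcal C$ (existence and uniqueness of such a field are known). *)

(* Defs.v *)
(* MathComp-Analysis, over an arbitrary [R : realType]. *)
From HB Require Import structures.
From mathcomp Require Import all_boot all_order all_algebra.
From mathcomp Require Import all_classical all_reals all_analysis.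
From mathcomp Require Import ring lra.

Set Implicit Arguments.
Unset Strict Implicit.
Unset Printing Implicit Defensive.

Import Order.TTheory GRing.Theory Num.Theory.
Import numFieldTopology.Exports numFieldNormedType.Exports.

Local Open Scope classical_set_scope.
Local Open Scope ring_scope.

Definition usquare (R : realType) : set (R * R) :=
  `[0, 1]%classic `*` `[0, 1]%classic.

Definition osquare (R : realType) : set (R * R) :=
  `]0, 1[%classic `*` `]0, 1[%classic.

Arguments usquare R : clear implicits.
Arguments osquare R : clear implicits.

Record is_copula (R : realType) (C : R * R -> R) : Prop := IsCopula {
  copula_u0 : forall u, 0 <= u <= 1 -> C (u, 0) = 0 ;
  copula_0v : forall v, 0 <= v <= 1 -> C (0, v) = 0 ;
  copula_u1 : forall u, 0 <= u <= 1 -> C (u, 1) = u ;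
  copula_1v : forall v, 0 <= v <= 1 -> C (1, v) = v ;
  copula_2incr : forall u1 u2 v1 v2,
    0 <= u1 -> u1 <= u2 -> u2 <= 1 -> 0 <= v1 -> v1 <= v2 -> v2 <= 1 ->
    0 <= C (u2, v2) - C (u2, v1) - C (u1, v2) + C (u1, v1) }.

(* A function on [0, 1]^2 is encoded by its extension by 0 to R^2, so that
   Leibniz equality of copulas is equality of functions on [0, 1]^2. *)
Record copula (R : realType) := Copula {
  copula_fun :> R * R -> R ;
  copula_is_copula : is_copula copula_fun ;
  copula_out : forall p, ~ usquare R p -> copula_fun p = 0 }.

Section copula_of.
Variables (R : realType) (f : R * R -> R) (fC : is_copula f).

Lemma usquareE (u v : R) : 0 <= u <= 1 -> 0 <= v <= 1 ->
  (f \_ (usquare R)) (u, v) = f (u, v).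
Proof.
by move=> hu hv; rewrite patchE mem_set//; split; rewrite /= in_itv.
Qed.

Lemma copula_of_is_copula : is_copula (f \_ (usquare R)).
Proof.
split.
- by move=> u hu; rewrite usquareE ?lexx ?ler01// copula_u0.
- by move=> u hu; rewrite usquareE ?lexx ?ler01// copula_0v.
- by move=> u hu; rewrite usquareE ?lexx ?ler01// copula_u1.
- by move=> u hu; rewrite usquareE ?lexx ?ler01// copula_1v.
- move=> u1 u2 v1 v2 *; rewrite !usquareE; first exact: copula_2incr.
  all: by apply/andP; split; lra.
Qed.

Lemma copula_of_out p : ~ usquare R p -> (f \_ (usquare R)) p = 0.
Proof. by move=> np; rewrite patchE memNset. Qed.

Definition copula_of : copula R := Copula copula_of_is_copula copula_of_out.

End copula_of.

Section special_copulas.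
Variable R : realType.

Lemma is_copula_M : is_copula (fun p : R * R => Num.min p.1 p.2).
Proof.
split=> /=.
- by move=> u /andP[u0 u1]; case: leP => *; lra.
- by move=> u /andP[u0 u1]; case: leP => *; lra.
- by move=> u /andP[u0 u1]; case: leP => *; lra.
- by move=> u /andP[u0 u1]; case: leP => *; lra.
- move=> u1 u2 v1 v2 *.
  by case: (leP u2 v2); case: (leP u2 v1); case: (leP u1 v2); case: (leP u1 v1);
    move=> *; lra.
Qed.

Lemma is_copula_W : is_copula (fun p : R * R => Num.max (p.1 + p.2 - 1) 0).
Proof.
split=> /=.
- by move=> u /andP[u0 u1]; case: leP => *; lra.
- by move=> u /andP[u0 u1]; case: leP => *; lra.
- by move=> u /andP[u0 u1]; case: leP => *; lra.
- by move=> u /andP[u0 u1]; case: leP => *; lra.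
- move=> u1 u2 v1 v2 *.
  by case: (leP (u2 + v2 - 1)); case: (leP (u2 + v1 - 1));
    case: (leP (u1 + v2 - 1)); case: (leP (u1 + v1 - 1)); move=> *; lra.
Qed.

Lemma is_copula_Pi : is_copula (fun p : R * R => p.1 * p.2).
Proof.
split=> /=.
- by move=> u _; rewrite mulr0.
- by move=> u _; rewrite mul0r.
- by move=> u _; rewrite mulr1.
- by move=> u _; rewrite mul1r.
- move=> u1 u2 v1 v2 *.
  have -> : u2 * v2 - u2 * v1 - u1 * v2 + u1 * v1 = (u2 - u1) * (v2 - v1).
    by ring.
  by rewrite mulr_ge0// subr_ge0.
Qed.

Definition copM : copula R := copula_of is_copula_M.
Definition copW : copula R := copula_of is_copula_W.
Definition copPi : copula R := copula_of is_copula_Pi.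

Lemma is_copula_mix (t : {i01 R}) (C D : copula R) :
  is_copula (fun p => (1 - t%:num) * C p + t%:num * D p).
Proof.
have t0 : 0 <= t%:num by [].
have t1 : 0 <= 1 - t%:num by rewrite subr_ge0.
have [C1 C2 C3 C4 C5] := copula_is_copula C.
have [D1 D2 D3 D4 D5] := copula_is_copula D.
split.
- by move=> u hu; rewrite C1// D1// !mulr0 addr0.
- by move=> u hu; rewrite C2// D2// !mulr0 addr0.
- by move=> u hu; rewrite C3// D3// -mulrDl subrK mul1r.
- by move=> u hu; rewrite C4// D4// -mulrDl subrK mul1r.
- move=> u1 u2 v1 v2 a1 a2 a3 a4 a5 a6.
  have := mulr_ge0 t1 (C5 _ _ _ _ a1 a2 a3 a4 a5 a6).
  have := mulr_ge0 t0 (D5 _ _ _ _ a1 a2 a3 a4 a5 a6).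
  move: (C _) (C _) (C _) (C _) (D _) (D _) (D _) (D _) => *; nra.
Qed.

(* The copula (1 - t) C + t D. *)
Definition mix (t : {i01 R}) (C D : copula R) : copula R :=
  copula_of (is_copula_mix t C D).

End special_copulas.

HB.instance Definition _ (R : realType) := gen_eqMixin (copula R).
HB.instance Definition _ (R : realType) := gen_choiceMixin (copula R).
HB.instance Definition _ (R : realType) := isPointed.Build (copula R) (copPi R).

Definition to_uniform (R : realType) (C : copula R) :
  {uniform` usquare R -> R} := copula_fun C.

(* The uniform topology on the set of copulas. *)
HB.instance Definition _ (R : realType) :=
  Uniform.copy (copula R) (initial_topology (@to_uniform R)).

Section symmetries.
Variable R : realType.

Definition sym_pi (p : R * R) : R * R := (p.2, p.1).
Definition sym_sigma1 (p : R * R) : R * R := (1 - p.1, p.2).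

(* The group generated by [sym_pi] and [sym_sigma1]: both generators are
   involutions, so closure under composition suffices.  Its elements are
   written as affine bijections of R^2, all of which preserve [0, 1]^2 and
   (0, 1)^2. *)
Inductive dihedral4 : (R * R -> R * R) -> Prop :=
| dihedral4_id : dihedral4 idfun
| dihedral4_pi : dihedral4 sym_pi
| dihedral4_sigma1 : dihedral4 sym_sigma1
| dihedral4_comp g h : dihedral4 g -> dihedral4 h -> dihedral4 (g \o h).

(* [mu] is the measure mu_C associated with C.  It is a Borel probability
   measure on R^2, necessarily concentrated on [0, 1]^2 because C(1, 1) = 1;
   the product sigma-algebra on R * R is the Borel one. *)
Definition copula_measure (C : copula R) (mu : probability (R * R)%type R) :=
  forall u v : R, 0 <= u <= 1 -> 0 <= v <= 1 ->
    mu (`[0, u]%classic `*` `[0, v]%classic) = (C (u, v))%:E.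

(* [is_image g C C'] : C' is the copula C^g, i.e., mu_{C'} = g_# mu_C. *)
Definition is_image (g : R * R -> R * R) (C C' : copula R) : Prop :=
  exists mu mu' : probability (R * R)%type R,
    [/\ copula_measure C mu, copula_measure C' mu' &
        forall A, measurable A -> mu' A = pushforward mu g A].

End symmetries.

Section concordance.
Variable R : realType.
Implicit Types (C D : copula R) (kappa : copula R -> R).

Definition copula_le C D : Prop := forall p, usquare R p -> C p <= D p.

Record measure_of_concordance kappa : Prop := MeasureOfConcordance {
  moc_sym : forall C C', is_image (@sym_pi R) C C' -> kappa C' = kappa C ;
  moc_mono : forall C D, copula_le C D -> kappa C <= kappa D ;
  moc_norm : kappa (copM R) = 1 ;
  moc_refl : forall C C', is_image (@sym_sigma1 R) C C' ->
    kappa C' = - kappa C ;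
  moc_cont : forall (Cn : nat -> copula R) C,
    Cn @ \oo --> C -> kappa (Cn n) @[n --> \oo] --> kappa C }.

Definition degree_le2 kappa : Prop := forall C D,
  exists2 p : {poly R}, (size p <= 3)%N &
    forall t : {i01 R}, kappa (mix t C D) = p.[t%:num].

Definition affine kappa : Prop := forall C D (t : {i01 R}),
  kappa (mix t C D) = (1 - t%:num) * kappa C + t%:num * kappa D.

Definition exact_degree2 kappa : Prop := degree_le2 kappa /\ ~ affine kappa.

Lemma half_ge0 : 0 <= 2^-1 :> R. Proof. by lra. Qed.
Lemma half_le1 : 2^-1 <= 1 :> R. Proof. by lra. Qed.
Definition half : {i01 R} := Itv01 half_ge0 half_le1.

Definition polarization kappa C D : R :=
  2 * kappa (mix half C D) - (kappa C + kappa D) / 2.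

End concordance.

(* A Borel measure on (0, 1)^2 is encoded as a Borel measure on R^2 which is
   concentrated on (0, 1)^2.  As a library measure takes arbitrary values on
   non-measurable sets, measures are compared on measurable sets only. *)
Notation plane_measure R := {measure set (R * R)%type -> \bar R}.

Section fields.
Variable R : realType.
Implicit Types (C D : copula R) (nu : plane_measure R)
  (F : copula R -> plane_measure R) (kappa : copula R -> R).

Definition wfun (p : R * R) : R := copM R p - copW R p.

Definition Mwplus nu : Prop :=
  nu (~` osquare R) = 0%E /\
  (\int[nu]_(p in osquare R) (wfun p)%:E < +oo)%E.

(* The integral of C - Pi over (0, 1)^2, as a real number. *)
Definition cint nu C : R := \int[nu]_(p in osquare R) (C p - copPi R p).

Record admissible F : Prop := Admissible {
  adm_P1 : forall C, Mwplus (F C) ;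
  adm_P2 : forall C D (t : {i01 R}) A, measurable A ->
    F (mix t C D) A = ((1 - t%:num)%:E * F C A + t%:num%:E * F D A)%E ;
  adm_P3 : forall C D,
    cint (F C) D - cint (F (copPi R)) D =
    cint (F D) C - cint (F (copPi R)) C ;
  adm_P4 : forall C C' g, dihedral4 g -> is_image g C C' ->
    forall A, measurable A -> F C' A = pushforward (F C) g A ;
  adm_P5 : continuous (fun C => cint (F (copPi R)) C + cint (F C) C) ;
  adm_P6 : cint (F (copPi R)) (copM R) + cint (F (copM R)) (copM R) = 1 }.

(* The admissible field representing kappa exists and is unique on Borel sets;
   neither fact is assumed here. *)
Definition associated_field kappa F : Prop :=
  admissible F /\
  forall C D, polarization kappa C D = cint (F (copPi R)) C + cint (F C) D.

Definition constant_field F : Prop :=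
  forall C D A, measurable A -> F C A = F D A.

End fields.

(* Main.v *)
(* Polarization turns affinity of kappa into [cint (nuk C) D = kappa D / 2] for
   all C and D, because kappa vanishes at Pi.  It remains to see that a measure
   in M_w^+ is determined by its integrals of D - Pi.  If f and g are
   L-Lipschitz and vanish at 0 and 1, then Pi + f (x) g / L^2 is a copula;
   taking for f and g trapezoids increasing to the indicators of open intervals
   recovers the measure of every open rectangle.  Conversely, if the field is
   constant, kappa is midpoint-affine, hence affine as its degree is at most
   two. *)
Require Import Defs.
From mathcomp Require Import all_boot all_order all_algebra.
From mathcomp Require Import all_classical all_reals all_analysis.
From mathcomp Require Import measurable_realfun ring lra.
Set Implicit Arguments.
Unset Strict Implicit.
Unset Printing Implicit Defensive.
Import Order.TTheory GRing.Theory Num.Theory.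
Import numFieldNormedType.Exports.
Local Open Scope classical_set_scope.
Local Open Scope ring_scope.

Arguments copula_fun : simpl never.

(** * Monotonicity, Fréchet-Hoeffding bounds and Borel measurability of copulas *)

Section copula_theory.
Context {R : realType}.
Implicit Types (C D : copula R) (u v : R).

Lemma osquareP (p : R * R) :
  osquare R p <-> (0 < p.1 < 1) /\ (0 < p.2 < 1).
Proof. by rewrite /osquare /= !in_itv. Qed.

(** Passing through [(u, v')], rectangles that reach the lower or left edge give monotonicity, and
    those that reach the upper or right edge give the Lipschitz bound. *)
Lemma copula_incr C u u' v v' :
  0 <= u -> u <= u' -> u' <= 1 -> 0 <= v -> v <= v' -> v' <= 1 ->
  0 <= C (u', v') - C (u, v) /\ C (u', v') - C (u, v) <= (u' - u) + (v' - v).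
Proof.
move=> u0 uu' u'1 v0 vv' v'1.
have [C1 C2 C3 C4 C5] := copula_is_copula C.
have := C5 u u' 0 v' u0 uu' u'1 (lexx _) ltac:(lra) v'1.
have := C5 u u' v' 1 u0 uu' u'1 ltac:(lra) v'1 (lexx _).
have := C5 0 u v v' (lexx _) u0 ltac:(lra) v0 vv' v'1.
have := C5 u 1 v v' u0 ltac:(lra) (lexx _) v0 vv' v'1.
rewrite !C1 ?C2 ?C3 ?C4; lra.
Qed.

Lemma copME u v : 0 <= u <= 1 -> 0 <= v <= 1 -> copM R (u, v) = Num.min u v.
Proof. exact: usquareE. Qed.

Lemma copWE u v : 0 <= u <= 1 -> 0 <= v <= 1 ->
  copW R (u, v) = Num.max (u + v - 1) 0.
Proof. exact: usquareE. Qed.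

Lemma copPiE u v : 0 <= u <= 1 -> 0 <= v <= 1 -> copPi R (u, v) = u * v.
Proof. exact: usquareE. Qed.

Lemma copula_ge_W_le_M C u v : 0 <= u <= 1 -> 0 <= v <= 1 ->
  copW R (u, v) <= C (u, v) <= copM R (u, v).
Proof.
move=> hu hv; rewrite copWE// copME//.
move: (hu) (hv) => /andP[u0 u1] /andP[v0 v1].
have [C1 C2 C3 C4 C5] := copula_is_copula C.
have := @copula_incr C 0 u v v ltac:(lra) ltac:(lra) ltac:(lra) ltac:(lra)
  ltac:(lra) ltac:(lra).
have := @copula_incr C u 1 v v ltac:(lra) ltac:(lra) ltac:(lra) ltac:(lra)
  ltac:(lra) ltac:(lra).
have := @copula_incr C u u v 1 ltac:(lra) ltac:(lra) ltac:(lra) ltac:(lra)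
  ltac:(lra) ltac:(lra).
rewrite C2// C3// C4// => -[a1 a2] [b1 b2] [c1 c2].
by rewrite ge_max le_min; apply/andP; split; apply/andP; lra.
Qed.

(** Both copulas lie between W and M, and [wfun] is M - W. *)
Lemma copula_distPi C (p : R * R) : osquare R p ->
  `|C p - copPi R p| <= wfun p.
Proof.
case: p => u v /osquareP[/= /andP[u0 u1] /andP[v0 v1]]; rewrite /wfun.
have := @copula_ge_W_le_M C u v ltac:(apply/andP; lra) ltac:(apply/andP; lra).
have := @copula_ge_W_le_M (copPi R) u v ltac:(apply/andP; lra)
  ltac:(apply/andP; lra).
by move=> /andP[a1 a2] /andP[b1 b2]; rewrite ler_norml; apply/andP; lra.
Qed.

Lemma wfun_ge0 (p : R * R) : osquare R p -> 0 <= wfun p.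
Proof. by move=> /(copula_distPi (copPi R)); exact: le_trans. Qed.

Lemma measurable_osquare : measurable (osquare R).
Proof. exact: measurableX. Qed.

(* Monotone and Lipschitz functions have superlevel sets which are countable
   unions of rational quadrants. *)
Lemma measurable_copula C : measurable_fun (osquare R) C.
Proof.
apply: (measurability (@RGenOInfty.G R)) => /=.
  exact: RGenOInfty.measurableE.
move=> _ [_ [a ->] <-].
have -> : osquare R `&` C @^-1` `]a, +oo[ =
    \bigcup_(q : rat) \bigcup_(r : rat)
    (osquare R `&` [set p : R * R | [/\ 0 <= ratr q :> R, 0 <= ratr r :> R &
       a < C (ratr q, ratr r)]] `&` (`[ratr q, +oo[ `*` `[ratr r, +oo[)).
  apply/seteqP; split => [[u v]|[u v] [q _ [r _ [[/[dup] /osquareP[/=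
      /andP[u0 u1] /andP[v0 v1]] o [/= q0 r0 aC]]]]]].
    move=> [/[dup] o /osquareP[/= /andP[u0 u1] /andP[v0 v1]]].
    rewrite in_itv/= andbT => aC.
    (* Lowering each coordinate by less than [d] lowers [C] by less than [2 * d], so the value stays
       above [a]. *)
    pose d := (C (u, v) - a) / 2.
    have d0 : 0 < d by rewrite /d; lra.
    have [q] := @rat_in_itvoo R (Num.max 0 (u - d)) u
      ltac:(rewrite gt_max; apply/andP; lra).
    rewrite in_itv/= gt_max => /andP[/andP[q0 q1] q2].
    have [r] := @rat_in_itvoo R (Num.max 0 (v - d)) v
      ltac:(rewrite gt_max; apply/andP; lra).
    rewrite in_itv/= gt_max => /andP[/andP[r0 r1] r2].
    exists q => //; exists r => //; split; [split=> //; split|split];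
      rewrite /= ?in_itv/= ?andbT; try lra.
    have := @copula_incr C (ratr q) u (ratr r) v ltac:(lra) ltac:(lra)
      ltac:(lra) ltac:(lra) ltac:(lra) ltac:(lra).
    rewrite /d in q1 r1; lra.
  case; rewrite /= !in_itv/= !andbT => qu rv; split => //.
  have := @copula_incr C (ratr q) u (ratr r) v q0 qu ltac:(lra) r0 rv ltac:(lra).
  lra.
apply: bigcupT_measurable_rat => q; apply: bigcupT_measurable_rat => r.
apply: measurableI; last by apply: measurableX.
have [h|h] := pselect [/\ 0 <= ratr q :> R, 0 <= ratr r :> R &
       a < C (ratr q, ratr r)].
  rewrite (_ : [set _ | _] = setT) ?setIT; first exact: measurable_osquare.
  by apply/seteqP; split.
rewrite (_ : [set _ | _] = set0) ?setI0; first exact: measurable0.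
by apply/seteqP; split.
Qed.

End copula_theory.

(** * Integrability against measures in [Mwplus] *)

Section integrability.
Context {R : realType}.
Implicit Types (C D : copula R) (nu : plane_measure R).

Lemma measurable_wfun : measurable_fun (osquare R) (@wfun R).
Proof. exact: (measurable_funB (measurable_copula _) (measurable_copula _)). Qed.

Lemma measurable_copB C :
  measurable_fun (osquare R) (fun p => C p - copPi R p).
Proof. exact: (measurable_funB (measurable_copula _) (measurable_copula _)). Qed.

Lemma Mwplus_integrable_wfun nu : Mwplus nu ->
  nu.-integrable (osquare R) (fun p => (wfun p)%:E).
Proof.
move=> [_ nuw]; apply/integrableP; split.
  by apply/measurable_EFinP; exact: measurable_wfun.
under eq_integral => p /[!inE] op do rewrite gee0_abs ?lee_fin ?wfun_ge0//.
exact: nuw.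
Qed.

(** Domination by [wfun]; hence [cint] is a true finite integral, not the value 0 that [fine] gives
    at infinity. *)
Lemma Mwplus_integrable C nu : Mwplus nu ->
  nu.-integrable (osquare R) (fun p => (C p - copPi R p)%:E).
Proof.
move=> /Mwplus_integrable_wfun; apply: le_integrable.
- exact: measurable_osquare.
- by apply/measurable_EFinP; exact: measurable_copB.
- move=> p op; rewrite !abse_EFin lee_fin [leRHS]ger0_norm ?wfun_ge0//.
  exact: copula_distPi.
Qed.

(** Serves to build [nu] as the sum of a measure of the field with itself. *)
Lemma Mwplus_add nu1 nu2 : Mwplus nu1 -> Mwplus nu2 ->
  Mwplus (measure_add nu1 nu2).
Proof.
move=> h1 h2; split.
  by have := measure_addE nu1 nu2 (~` osquare R); rewrite h1.1 h2.1 adde0.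
have i1 := Mwplus_integrable_wfun h1; have i2 := Mwplus_integrable_wfun h2.
rewrite integral_measure_add//; last exact: measurable_osquare.
exact: lte_add_pinfty h1.2 h2.2.
Qed.

Lemma cint_measure_add nu1 nu2 C : Mwplus nu1 -> Mwplus nu2 ->
  cint (measure_add nu1 nu2) C = cint nu1 C + cint nu2 C.
Proof.
move=> /(Mwplus_integrable C) i1 /(Mwplus_integrable C) i2.
have mo := @measurable_osquare R.
by rewrite /cint /Rintegral integral_measure_add// fineD// integrable_fin_num.
Qed.

Lemma eq_cint nu1 nu2 C : (forall A, measurable A -> nu1 A = nu2 A) ->
  cint nu1 C = cint nu2 C.
Proof.
by move=> h; congr fine; apply: eq_measure_integral => A mA _; exact: h.
Qed.

Lemma cint_copPi nu : cint nu (copPi R) = 0.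
Proof.
rewrite /cint /Rintegral integral0_eq// => p _; by rewrite subrr.
Qed.

End integrability.

(** * Mixtures, polarization and affinity *)

Section polarization_theory.
Context {R : realType}.
Implicit Types (C D : copula R) (kappa : copula R -> R).

Lemma copula_eq C D : copula_fun C = copula_fun D -> C = D.
Proof.
case: C D => [f fC f0] [g gC g0]; rewrite /copula_fun => fg.
subst g; congr Copula; exact: Prop_irrelevance.
Qed.

(** Valid on the whole plane because both sides vanish off the square; with [copula_eq] it reduces
    identities between copulas to pointwise algebra. *)
Lemma mixE t C D p : mix t C D p = (1 - t%:num) * C p + t%:num * D p.
Proof.
rewrite {1}/copula_fun/= patchE; case: ifPn => //.
by rewrite notin_setE => np; rewrite !copula_out// !mulr0 addr0.
Qed.

Lemma mix_same t C : mix t C C = C.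
Proof. by apply: copula_eq; apply/funext => p; rewrite mixE; lra. Qed.

Lemma polarization_same kappa C : polarization kappa C C = kappa C.
Proof. by rewrite /polarization mix_same; lra. Qed.

Lemma mix0 C D : mix (Itv01 (lexx 0) ler01) C D = C.
Proof. by apply: copula_eq; apply/funext => p; rewrite mixE /=; lra. Qed.

Lemma mix1 C D : mix (Itv01 ler01 (lexx 1)) C D = D.
Proof. by apply: copula_eq; apply/funext => p; rewrite mixE /=; lra. Qed.

Lemma affine_polarization kappa C D : affine kappa ->
  polarization kappa C D = (kappa C + kappa D) / 2.
Proof. by move=> a; rewrite /polarization a /=; lra. Qed.

(* A polynomial of degree at most two is affine as soon as its value at 1/2 is
   the mean of its values at 0 and 1. *)
Lemma degree_le2_affine kappa : degree_le2 kappa ->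
  (forall C D, polarization kappa C D = (kappa C + kappa D) / 2) ->
  affine kappa.
Proof.
move=> deg pol C D t; have [p sp pE] := deg C D.
have pv x : p.[x] = p`_0 + p`_1 * x + p`_2 * x ^+ 2.
  rewrite (horner_coef_wide _ sp) !big_ord_recl big_ord0 /=.
  by rewrite expr0 expr1 mulr1 addr0 addrA.
have := pE (Itv01 ler01 (lexx 1)); have := pE (Itv01 (lexx 0) ler01).
rewrite mix0 mix1; have := pol C D; rewrite /polarization !pE !pv /=.
move: (p`_0) (p`_1) (p`_2) => a b c h kC kD.
(* The midpoint hypothesis reads [2a + b + c/2 = 2a + b + c]. *)
have c0 : c = 0 by rewrite kC kD in h; lra.
by rewrite kC kD c0; ring.
Qed.
End polarization_theory.

(** * Lipschitz approximation of indicators of intervals *)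

Section trapezoid.
Context {R : realType}.
Implicit Types (a b x y L : R).

(** Slope [L] up from [a], cap at 1, slope [-L] down to [b]; for [b <= a] it is identically 0,
    matching the empty interval. *)
Definition trapezoid a b L x :=
  Num.min 1 (L * Num.max 0 (Num.min (x - a) (b - x))).

Lemma trapezoid_ge0 a b L x : 0 <= L -> 0 <= trapezoid a b L x.
Proof. by move=> L0; rewrite le_min ler01 mulr_ge0// le_max lexx. Qed.

Lemma trapezoid_out a b L x : ~~ (a < x < b) -> trapezoid a b L x = 0.
Proof.
move=> xab; have h : Num.min (x - a) (b - x) <= 0.
  by rewrite leNgt lt_min !subr_gt0.
by rewrite /trapezoid (max_l h) mulr0 min_r.
Qed.

Lemma trapezoid_homo a b L L' x : L <= L' ->
  trapezoid a b L x <= trapezoid a b L' x.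
Proof.
move=> LL'; rewrite le_min ge_min lexx/= ge_min; apply/orP; right.
by rewrite ler_wpM2r// le_max lexx.
Qed.

(** The minimum of two functions of slope 1 and -1 is 1-Lipschitz; clipping at 0 or at 1 does not
    increase distances, and the factor [L] scales the bound. *)
Lemma trapezoid_lipschitz a b L x y : 0 <= L -> x <= y ->
  `|trapezoid a b L y - trapezoid a b L x| <= L * (y - x).
Proof.
move=> L0 xy; pose t z := Num.max 0 (Num.min (z - a) (b - z)).
have tL : `|t y - t x| <= y - x.
  have : `|Num.min (y - a) (b - y) - Num.min (x - a) (b - x)| <= y - x.
    case: (leP (y - a)) => ?; case: (leP (x - a)) => ?;
    by rewrite ler_norml; apply/andP; lra.
  rewrite /t; move: (Num.min _ _) (Num.min _ _) => r s; apply: le_trans.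
  have := ler_norm (r - s); have := ler_norm (s - r); rewrite distrC ler_norml.
  by case: (leP 0 r) => ?; case: (leP 0 s) => ? ? ?; apply/andP; lra.
move: tL; move=> /(ler_wpM2l L0); rewrite -{1}(ger0_norm L0) -normrM mulrBr.
rewrite /trapezoid -/(t x) -/(t y); move: (L * t x) (L * t y) => s r.
apply: le_trans.
have := ler_norm (r - s); have := ler_norm (s - r); rewrite distrC ler_norml.
by case: (leP 1 r) => ?; case: (leP 1 s) => ? ? ?; apply/andP; lra.
Qed.

(** The cap is active once [n] is at least the inverse of the distance from [x] to the endpoints. *)
Lemma trapezoid_near1 a b x : a < x < b ->
  \forall n \near \oo, trapezoid a b n.+1%:R x = 1.
Proof.
move=> /andP[ax xb]; have t0 : 0 < Num.min (x - a) (b - x).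
  by rewrite lt_min !subr_gt0 ax.
near=> n; rewrite /trapezoid max_r ?(ltW t0)// min_l// -ler_pdivrMr//.
rewrite -natr1 (@le_trans _ _ n%:R) ?lerDl//.
near: n; exact: nbhs_infty_ger.
Unshelve. all: end_near. Qed.

End trapezoid.

(** * Perturbations of the product copula *)

Section copPi_perturb.
Context {R : realType}.
Variables (f g : R -> R) (L : R).
Hypotheses (L0 : 0 < L) (f0 : f 0 = 0) (f1 : f 1 = 0) (g0 : g 0 = 0)
  (g1 : g 1 = 0).
Hypothesis f_lip : forall x y, x <= y -> `|f y - f x| <= L * (y - x).
Hypothesis g_lip : forall x y, x <= y -> `|g y - g x| <= L * (y - x).

(** The zeros of [f] and [g] at 0 and 1 preserve the margins. The Lipschitz bounds make the
    perturbation change the mass of a rectangle by at most its area, so the mass stays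
    non-negative. *)
Lemma is_copula_Pi_perturb :
  is_copula (fun p : R * R => p.1 * p.2 + f p.1 * g p.2 / L ^+ 2).
Proof.
split=> /=.
- by move=> u _; rewrite g0; ring.
- by move=> u _; rewrite f0; ring.
- by move=> u _; rewrite g1; ring.
- by move=> u _; rewrite f1; ring.
- move=> u1 u2 v1 v2 _ u12 _ _ v12 _.
  have -> : u2 * v2 + f u2 * g v2 / L ^+ 2 - (u2 * v1 + f u2 * g v1 / L ^+ 2) -
      (u1 * v2 + f u1 * g v2 / L ^+ 2) + (u1 * v1 + f u1 * g v1 / L ^+ 2) =
      (u2 - u1) * (v2 - v1) + (f u2 - f u1) * (g v2 - g v1) / L ^+ 2.
    by ring.
  rewrite -[X in X + _](mulfK (lt0r_neq0 (exprn_gt0 2 L0))) -mulrDl.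
  rewrite divr_ge0 ?exprn_ge0 ?(ltW L0)//.
  have : `|(f u2 - f u1) * (g v2 - g v1)| <= L * (u2 - u1) * (L * (v2 - v1)).
    by rewrite normrM ler_pM// ?f_lip ?g_lip.
  rewrite ler_norml => /andP[h _].
  have -> : (u2 - u1) * (v2 - v1) * L ^+ 2 = L * (u2 - u1) * (L * (v2 - v1)).
    by ring.
  lra.
Qed.

End copPi_perturb.

(** * Measures of open rectangles as limits of [cint] *)

Section rectangle.
Context {R : realType}.
Variables (a b c d : R).
Hypotheses (a0 : 0 <= a) (b1 : b <= 1) (c0 : 0 <= c) (d1 : d <= 1).

Let h n (p : R * R) :=
  trapezoid a b n.+1%:R p.1 * trapezoid c d n.+1%:R p.2.

Lemma is_copula_rect_bump n : is_copula (fun p : R * R =>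
  p.1 * p.2 + trapezoid a b n.+1%:R p.1 * trapezoid c d n.+1%:R p.2
    / n.+1%:R ^+ 2).
Proof.
apply: is_copula_Pi_perturb; rewrite ?ltr0Sn//.
(* The points 0 and 1 lie outside both open intervals, so all four boundary values are 0. *)
1-4: by apply: trapezoid_out; rewrite !ltNge ?a0 ?b1 ?c0 ?d1 ?andbF.
all: by move=> x y; exact: trapezoid_lipschitz.
Qed.

Definition rect_bump n : copula R := copula_of (is_copula_rect_bump n).

Let rect : set (R * R) := `]a, b[ `*` `]c, d[.

Let rect_osquare : rect `<=` osquare R.
Proof.
move=> [u v]; rewrite /rect /= !in_itv/= => -[/andP[au ub] /andP[cv vd]].
apply/osquareP; rewrite /= (le_lt_trans a0 au) (lt_le_trans ub b1).
by rewrite (le_lt_trans c0 cv) (lt_le_trans vd d1).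
Qed.

Let rect_bumpE n p : osquare R p ->
  h n p = n.+1%:R ^+ 2 * (rect_bump n p - copPi R p).
Proof.
case: p => u v /osquareP[/= /andP[u0 u1] /andP[v0 v1]].
have hu : 0 <= u <= 1 by apply/andP; lra.
have hv : 0 <= v <= 1 by apply/andP; lra.
rewrite copPiE// /rect_bump /copula_fun/= usquareE//= addrAC subrr add0r.
by rewrite mulrC divfK.
Qed.

(** The factor [n.+1%:R ^+ 2] undoes the scaling in [rect_bump]: each term is the integral of [h n],
    which increases to the indicator of the rectangle, so monotone convergence applies. *)
Lemma Mwplus_rect (nu : plane_measure R) : Mwplus nu ->
  nu (`]a, b[ `*` `]c, d[) =
  limn (fun n => (n.+1%:R ^+ 2 * cint nu (rect_bump n))%:E).
Proof.
move=> nuw; have mo := @measurable_osquare R.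
have mrect : measurable rect by exact: measurableX.
have -> : (fun n => (n.+1%:R ^+ 2 * cint nu (rect_bump n))%:E) =
    (fun n => \int[nu]_(p in osquare R) (h n p)%:E)%E.
  apply/funext => n.
  under eq_integral => p /[!inE] op do rewrite rect_bumpE// EFinM.
  have i := Mwplus_integrable (rect_bump n) nuw.
  by rewrite integralZl// EFinM /cint /Rintegral fineK// integrable_fin_num.
rewrite -monotone_convergence//; last 3 first.
- move=> n; apply/measurable_EFinP.
  apply: (@eq_measurable_fun _ _ _ _ _
    (fun p => n.+1%:R ^+ 2 * (rect_bump n p - copPi R p))).
    by move=> p /[!inE] op; rewrite rect_bumpE.
  by apply: measurable_funM; [exact: measurable_cst|exact: measurable_copB].
- by move=> n p _; rewrite lee_fin mulr_ge0// trapezoid_ge0.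
- move=> p _ n m nm; rewrite lee_fin.
  by rewrite ler_pM ?trapezoid_ge0// trapezoid_homo// ler_nat ltnS.
rewrite -/rect -[rect in LHS](setIidl rect_osquare) -integral_indic//.
(* Pointwise convergence is eventual equality: inside the rectangle both trapezoids reach 1, outside
   it one of them is always 0. *)
apply: eq_integral => -[u v] _; apply/esym/lim_near_cst => //.
rewrite indicE; have [/set_mem|] := boolP ((u, v) \in rect).
  rewrite /rect /= !in_itv/= => -[uab vcd].
  have ua := trapezoid_near1 uab; have vc := trapezoid_near1 vcd.
  near=> n; congr EFin; rewrite /h /=.
  have -> : trapezoid a b n.+1%:R u = 1 by near: n.
  have -> : trapezoid c d n.+1%:R v = 1 by near: n.
  by rewrite mulr1.
rewrite notin_setE /rect /= !in_itv/= => /not_andP uv.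
near=> n; rewrite /h /=.
by case: uv => /negP/trapezoid_out ->; rewrite ?mul0r ?mulr0.
Unshelve. all: end_near. Qed.

End rectangle.

(** * Determination of a measure by its integrals of [D - Pi] *)

Section uniqueness.
Context {R : realType}.

(** [setT] is included so that [quadrants] contains the whole plane and the preimages of rays under
    both projections. *)
Let rays : set (set R) := [set A | A = setT \/ exists a, A = `]a, +oo[%classic].

Let quadrants : set (set (R * R)) :=
  [set A `*` B | A in rays & B in rays].

Let raysI : setI_closed rays.
Proof.
move=> _ _ [->|[a ->]] [->|[b ->]].
- by left; rewrite setIT.
- by right; exists b; rewrite setTI.
- by right; exists a; rewrite setIT.
- right; exists (Num.max a b); apply/seteqP; split=> x /=;
    by rewrite !in_itv/= !andbT gt_max => /andP.
Qed.

Let rays_measurable A : rays A -> measurable A.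
Proof. by case=> [->|[a ->]]. Qed.

Lemma measurable_rays : @measurable _ R = <<s rays >>.
Proof.
apply/seteqP; split => [A|].
  rewrite -[measurable A]/((ocitv (R:=R)).-sigma.-measurable A).
  rewrite RGenOInfty.measurableE; apply: smallest_sub.
    exact: smallest_sigma_algebra.
  by move=> B [x ->]; apply: sub_gen_smallest; right; exists x.
apply: smallest_sub; first exact: sigma_algebra_measurable.
exact: rays_measurable.
Qed.

(** A measurable rectangle is an intersection of preimages under the two projections, and these are
    measurable for the generated sigma-algebra because the preimage of a ray is a quadrant. *)
Lemma measurable_quadrants : @measurable _ (R * R)%type = <<s quadrants >>.
Proof.
apply/seteqP; split.
  rewrite measurable_prod_measurableType; apply: smallest_sub.
    exact: smallest_sigma_algebra.
  move=> _ [A mA [B mB <-]].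
  have mfst : @measurable_fun _ _ (g_sigma_algebraType quadrants) R setT fst.
    apply: (measurability rays measurable_rays) => _ [C rC <-].
    rewrite setTI; apply: sub_gen_smallest; exists C => //; exists setT => //.
      by left.
    by apply/seteqP; split => -[x y]//= [].
  have msnd : @measurable_fun _ _ (g_sigma_algebraType quadrants) R setT snd.
    apply: (measurability rays measurable_rays) => _ [C rC <-].
    rewrite setTI; apply: sub_gen_smallest; exists setT; first by left.
    by exists C => //; apply/seteqP; split => -[x y]//= [].
  have := mfst measurableT _ mA; have := msnd measurableT _ mB.
  rewrite !setTI => h1 h2.
  exact: (@measurableI _ (g_sigma_algebraType quadrants) _ _ h2 h1).
apply: smallest_sub; first exact: sigma_algebra_measurable.
by move=> _ [A rA [B rB <-]]; apply: measurableX; exact: rays_measurable.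
Qed.

Let delta k : R := k.+2%:R^-1.

(** Measures in [Mwplus] can have infinite mass near the boundary; these smaller squares have finite
    mass and exhaust [osquare R]. *)
Let core k : set (R * R) :=
  `]delta k, 1 - delta k[ `*` `]delta k, 1 - delta k[.

Let delta_gt0 k : 0 < delta k.
Proof. by rewrite invr_gt0 ltr0Sn. Qed.

Let measurable_core k : measurable (core k).
Proof. exact: measurableX. Qed.

Let core_osquare k : core k `<=` osquare R.
Proof.
move=> [u v]; rewrite /core /= !in_itv/= => -[/andP[? ?] /andP[? ?]].
have := delta_gt0 k => ?.
by apply/osquareP; split => /=; apply/andP; lra.
Qed.

Let core_homo : {homo core : n m / (n <= m)%N >-> n `<=` m}.
Proof.
move=> n m nm [u v]; rewrite /core /= !in_itv/= => -[/andP[? ?] /andP[? ?]].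
have : delta m <= delta n by rewrite lef_pV2 ?posrE// ler_nat !ltnS.
by move=> ?; split; apply/andP; lra.
Qed.

Let bigcup_core : \bigcup_k core k = osquare R.
Proof.
apply/seteqP; split => [p [k _]|]; first exact: core_osquare.
move=> [u v] /osquareP[/= /andP[u0 u1] /andP[v0 v1]].
pose m := Num.min (Num.min u (1 - u)) (Num.min v (1 - v)).
have m0 : 0 < m by rewrite !lt_min !subr_gt0 u0 u1 v0 v1.
have [k km] : exists k, delta k < m.
  (* This [k] satisfies [1 / m < k + 1 <= k + 2]. *)
  exists (Num.truncn m^-1); rewrite invf_plt ?posrE//.
  by rewrite (lt_le_trans (truncnS_gt _))// ler_nat.
exists k => //; move: km; rewrite /m !lt_min => /andP[/andP[? ?] /andP[? ?]].
by rewrite /core /= !in_itv/=; split; apply/andP; lra.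
Qed.

(* [w] is bounded away from 0 on each [core k]. *)
Let core_finite (nu : plane_measure R) k : Mwplus nu -> (nu (core k) < +oo)%E.
Proof.
move=> [_ nuw]; have mo := @measurable_osquare R.
(* Markov's inequality, from [wfun >= delta k] on [core k]. *)
have le1 : ((delta k)%:E * nu (core k) <=
    \int[nu]_(p in osquare R) (wfun p)%:E)%E.
  rewrite -[core k in leLHS](setIidl (@core_osquare k)) -integral_indic//.
  rewrite -ge0_integralZl//; last 2 first.
  - by apply/measurable_EFinP; exact: measurable_indic.
  - by rewrite lee_fin ltW.
  apply: ge0_le_integral => //.
  - by move=> p _; rewrite mule_ge0// lee_fin// ltW.
  - by apply: emeasurable_funM => //; apply/measurable_EFinP;
      exact: measurable_indic.
  - by apply/measurable_EFinP; exact: measurable_wfun.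
  move=> p po; rewrite -EFinM lee_fin indicE.
  have [/set_mem|_] := boolP (p \in core k); last by rewrite mulr0 wfun_ge0.
  case: p po => u v /osquareP[/= /andP[? ?] /andP[? ?]].
  rewrite /core/= !in_itv/= => -[/andP[? ?] /andP[? ?]].
  rewrite mulr1 /wfun copME ?copWE; do ?by apply/andP; lra.
  rewrite lerBrDr le_min -!lerBrDl !ge_max; apply/andP; split; apply/andP; lra.
have := le_lt_trans le1 nuw; have := measure_ge0 nu (core k).
by case: (nu (core k)) => [r|//|//]; rewrite ?ltry// gt0_muley// lte_fin.
Qed.

(** Makes the trace of a quadrant on [core k] an open rectangle, possibly empty; [x <= a] keeps its
    lower ends non-negative, as [Mwplus_rect] requires. *)
Let ray_itv A x y : rays A ->
  exists2 a, x <= a & A `&` `]x, y[ = `]a, y[%classic.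
Proof.
case=> [->|[b ->]]; first by exists x => //; rewrite setTI.
exists (Num.max x b); first by rewrite le_max lexx.
apply/seteqP; split=> z /=; rewrite !in_itv/= andbT gt_max.
  by move=> [bz /andP[xz zy]]; rewrite xz bz.
by move=> /andP[/andP[-> ->] ->].
Qed.

(** Restricted to [core k], both measures are finite and agree on the quadrants, a generating
    pi-system, hence on all Borel sets. Continuity from below then passes to the open square. *)
Lemma Mwplus_unique (nu1 nu2 : plane_measure R) :
  Mwplus nu1 -> Mwplus nu2 -> (forall C, cint nu1 C = cint nu2 C) ->
  forall A, measurable A -> nu1 A = nu2 A.
Proof.
move=> nu1w nu2w eq_nu; have mo := @measurable_osquare R.
have eq_core k A : measurable A -> nu1 (A `&` core k) = nu2 (A `&` core k).
  apply: (measure_unique quadrants (fun=> setT) measurable_quadrants _ _ _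
    (mrestr nu1 (measurable_core k)) (mrestr nu2 (measurable_core k))).
  - move=> _ _ [A1 rA1 [B1 rB1 <-]] [A2 rA2 [B2 rB2 <-]].
    rewrite -setXI; exists (A1 `&` A2); first exact: raysI.
    by exists (B1 `&` B2) => //; exact: raysI.
  - by move=> _; exists setT; [left|exists setT; [left|rewrite setXTT]].
  - by rewrite bigcup_const.
  - move=> _ [A1 rA1 [B1 rB1 <-]]; rewrite /= /mrestr /core -setXI.
    have [a da ->] := ray_itv (delta k) (1 - delta k) rA1.
    have [c dc ->] := ray_itv (delta k) (1 - delta k) rB1.
    have d0 := delta_gt0 k; have d1 : 1 - delta k <= 1 by lra.
    have a0 := le_trans (ltW d0) da; have c0 := le_trans (ltW d0) dc.
    rewrite !(Mwplus_rect a0 d1 c0 d1)//.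
    by congr (limn _); apply/funext => n; rewrite eq_nu.
  - by move=> _; rewrite /= /mrestr setTI; exact: core_finite.
(* There is no mass outside the open square, so the cores exhaust all of [nu A]. *)
have osq (nu : plane_measure R) A : Mwplus nu -> measurable A ->
    nu (A `&` core k) @[k --> \oo] --> nu A.
  move=> [nu0 _] mA.
  have -> : nu A = nu (\bigcup_k (A `&` core k)).
    rewrite -setI_bigcupr bigcup_core.
    have h : nu (A `\` osquare R) = 0%E by apply: subset_measure0 nu0;
      [exact: measurableD|exact: measurableC|move=> ? []].
    transitivity (nu (A `\` osquare R) + nu (A `&` osquare R))%E.
      exact: measureDI.
    by rewrite h add0e.
  apply: nondecreasing_cvg_mu.
  - by move=> k; exact: measurableI.
  - by apply: bigcup_measurable => k _; exact: measurableI.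
  - by move=> n m nm; apply/subsetPset; apply: setIS; exact: core_homo.
move=> A mA; apply: (cvg_unique _ (osq _ _ nu1w mA)) => //.
have -> : (fun k => nu1 (A `&` core k)) = (fun k => nu2 (A `&` core k)).
  by apply/funext => k; exact: eq_core.
exact: osq.
Qed.

End uniqueness.

Theorem mainTheorem2 (R : realType) (kappa : copula R -> R)
    (nuk : copula R -> plane_measure R)
    (hkappa : measure_of_concordance kappa)
    (hdeg : degree_le2 kappa)
    (hnuk : associated_field kappa nuk) :
  [/\ affine kappa <-> constant_field nuk,
      constant_field nuk <->
        (exists nu : plane_measure R,
          [/\ Mwplus nu,
              forall C A, measurable A -> nuk C A = ((2^-1)%:E * nu A)%E &
              forall C, kappa C = cint nu C])
    & exact_degree2 kappa <-> ~ constant_field nuk].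
Proof.
have [adm pol] := hnuk.
have P1 := adm_P1 adm.
have kPi : kappa (copPi R) = 0.
  by rewrite -polarization_same pol !cint_copPi addr0.
have affine_constant : affine kappa -> constant_field nuk.
  move=> aff.
  have cintE C D : cint (nuk C) D = kappa D / 2.
    (* The second argument Pi gives [cint (nuk (copPi R)) C = kappa C / 2]; subtracting this from
       the general case leaves the claim. *)
    have := pol C D; have := pol C (copPi R).
    by rewrite !affine_polarization// cint_copPi kPi; lra.
  by move=> C D; apply: Mwplus_unique => // E; rewrite !cintE.
have constant_pol : constant_field nuk -> forall C D,
    polarization kappa C D = cint (nuk (copPi R)) C + cint (nuk (copPi R)) D.
  move=> cst C D; rewrite pol; congr +%R.
  by apply: eq_cint => A; exact: cst.
have constant_affine : constant_field nuk -> affine kappa.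
  move=> /constant_pol cpol; apply: degree_le2_affine => // C D.
  (* On the diagonal, [kappa] is twice the integral against the common measure, so the polarization
     is the mean of the two values. *)
  by rewrite -[kappa C]polarization_same -[kappa D]polarization_same !cpol; lra.
split; first by split.
- split=> [cst|[nu [_ nuE _]] C D A mA]; last by rewrite !nuE.
  (* The field is to be half of [nu], so [nu] is twice the common measure. *)
  exists (measure_add (nuk (copPi R)) (nuk (copPi R))); split.
  + exact: Mwplus_add.
  + move=> C A mA; rewrite (cst C (copPi R) A mA).
    rewrite [X in (_ * X)%E](measure_addE (nuk (copPi R)) (nuk (copPi R))).
    have : (0 <= nuk (copPi R) A)%E by exact: measure_ge0.
    (* The mass of [A] may be infinite, so halving the doubled value is checked separately at
       [+oo]. *)
    case: (nuk (copPi R) A) => [r _|_|//].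
      by rewrite -EFinD -EFinM; congr EFin; lra.
    by rewrite addye// gt0_muley// lte_fin invr_gt0.
  + by move=> C; rewrite cint_measure_add// -constant_pol// polarization_same.
- split=> [[_ naff] /constant_affine//|ncst]; split=> //.
  by move=> /affine_constant.
Qed.
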